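(* There exist absolute constants $C,C'>0$ such that for all integers $n\ge2$ and $m$ with $\frac{2m}{n}\ge1$ and $m\le\binom n2$, a random graph $G\in\mathcal G(n,m)$ satisfies $\Pr\left[\mathrm{cub}(G)\le C\,\frac{2m}{n}\log n\right]\ge 1-\frac{C'}{n}$. (That is, $\Pr[\mathrm{cub}(G)\in O(\frac{2m}{n}\log n)]\ge1-\frac1{\Omega(n)}$.)
   Context: $\mathcal G(n,m)$ is the model of a uniformly random simple graph on $n$ labelled vertices with exactly $m$ edges; $\log$ is the natural logarithm. The cubicity $\mathrm{cub}(G)$ is the minimum integer $k\ge0$ such that each vertex of $G$ can be assigned a $k$-cube (a Cartesian product of $k$ closed unit-length intervals on the real line) so that two distinct vertices are adjacent iff their cubes intersect. *)

(* Defs.v *)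
From HB Require Import structures.
From mathcomp Require Import all_boot all_order all_algebra.
From mathcomp Require Import all_classical all_reals all_analysis.

Set Implicit Arguments.
Unset Strict Implicit.
Unset Printing Implicit Defensive.

Import Order.TTheory GRing.Theory Num.Theory.

Local Open Scope classical_set_scope.
Local Open Scope ring_scope.

Record sgraph (T : finType) := SGraph {
  edges : {set {set T}};
  edges_card2 : [forall e in edges, #|e| == 2%N] }.

HB.instance Definition _ (T : finType) := [isSub for @edges T].
HB.instance Definition _ (T : finType) := [Finite of sgraph T by <:].

Definition adj (T : finType) (G : sgraph T) (u v : T) : bool :=
  [set u; v]%SET \in edges G.

(* The unit cube with lower corner [a]; for k = 0 it is the one-point space. *)
Definition unit_cube (R : realType) (k : nat) (a : 'rV[R]_k) : set 'rV[R]_k :=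
  [set x | forall i, x 0 i \in `[a 0 i, a 0 i + 1]].

Definition cube_representable (R : realType) (T : finType) (G : sgraph T)
    (k : nat) : Prop :=
  exists a : T -> 'rV[R]_k, forall u v : T, u != v ->
    adj G u v <-> unit_cube (a u) `&` unit_cube (a v) !=set0.

(* One coordinate per vertex w: w, its neighbours and its non-neighbours start
   at 0, 1 and 2 respectively. *)
Lemma cube_representable_ex (R : realType) (T : finType) (G : sgraph T) :
  exists k, `[< cube_representable R G k >].
Proof.
exists #|T|; apply/asboolP.
pose f (w u : T) : R := if u == w then 0 else if adj G w u then 1 else 2.
have adjC u v : adj G u v = adj G v u by rewrite /adj finset.setUC.
have f_le2 w u : f w u <= 2.
  by rewrite /f; do 2?case: ifP => _; rewrite ?ler0n ?(ler_nat _ 1 2).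
have f_ge1 w u : u != w -> 1 <= f w u.
  by rewrite /f => /negbTE ->; case: ifP => _; rewrite ?(ler_nat _ 1 2).
have f_le w u v : u != v -> adj G u v -> f w v <= f w u + 1.
  move=> uv Guv; have [wu|uw] := eqVneq u w.
    by rewrite -wu /f eq_sym (negbTE uv) Guv eqxx add0r.
  by apply: le_trans (f_le2 w v) _; rewrite -[2]/(1 + 1) lerD2r f_ge1.
exists (fun u => \row_(i < #|T|) f (enum_val i) u) => u v uv; split.
- move=> Guv.
  exists (\row_i Num.max (f (enum_val i) u) (f (enum_val i) v)); split => i;
    rewrite !mxE in_itv /= le_max lexx ?orbT /= ge_max lerDl ler01 ?andbT /=.
  + exact: f_le.
  + by apply: f_le; rewrite 1?eq_sym // adjC.
- case=> x [/(_ (enum_rank u)) + /(_ (enum_rank u))].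
  rewrite !mxE !in_itv /= !enum_rankK /f eqxx eq_sym (negbTE uv) add0r.
  case: ifP => // _ /andP[_ x1] /andP[x2 _].
  by have := le_trans x2 x1; rewrite (ler_nat _ 2 1).
Qed.

Definition cubicity (R : realType) (T : finType) (G : sgraph T) : nat :=
  ex_minn (cube_representable_ex R G).

Definition Gnm (n m : nat) : {set sgraph 'I_n} :=
  [set G : sgraph 'I_n | #|edges G| == m]%SET.

(* Probability of the event [A] under the uniform distribution on [Gnm n m]. *)
Definition Pr_Gnm (R : realType) (n m : nat) (A : pred (sgraph 'I_n)) : R :=
  #|[set G in Gnm n m | A G]%SET|%:R / #|Gnm n m|%:R.

(* Main.v *)
Require Import Defs.
From mathcomp Require Import all_boot all_order all_algebra.
From mathcomp Require Import all_classical all_reals all_analysis.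
From mathcomp Require Import zify ring lra.

(* Order the vertices so that each has fewer than 2q earlier neighbours. For a
   set S of vertices, placing v in S at its rank and v outside S at n plus the
   rank of its first neighbour in S keeps adjacent vertices within distance n,
   and separates v from a later u as soon as v is in S while u and its earlier
   neighbours are not. A random S of density 1/(4q) does this with probability
   at least 1/(8q), so O(q log n) such coordinates separate all non-adjacent
   pairs. If every nonempty vertex set H spans fewer than q|H| edges, repeatedly
   removing a vertex of minimum degree gives such an order; for q of order m/n,
   a union bound over H and over the sets of q|H| edges inside H shows that this
   fails with probability at most 1/n. *)

Set Implicit Arguments.
Unset Strict Implicit.
Unset Printing Implicit Defensive.

Import Order.TTheory GRing.Theory Num.Theory.
Local Open Scope ring_scope.

(** * Cube representations by real coordinates, and covering by random sets *)

Lemma adjC (T : finType) (G : sgraph T) u v : adj G u v = adj G v u.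
Proof. by rewrite /adj finset.setUC. Qed.

(** Unit intervals meet exactly when their lower ends are at distance at most 1, and cubes meet
    exactly when they do so in every coordinate; the coordinatewise maximum of the two corners is
    then a common point. *)
Lemma cube_representable_dist (R : realType) (T : finType) (G : sgraph T) k
    (f : 'I_k -> T -> R) :
  (forall u v, u != v -> adj G u v = [forall i, `|f i u - f i v| <= 1]) ->
  cube_representable R G k.
Proof.
move=> fG; exists (fun u => \row_i f i u) => u v uv; rewrite fG //; split.
  move=> /forallP le1; exists (\row_i Num.max (f i u) (f i v)).
  split => i; rewrite !mxE in_itv /= le_max lexx ?orbT /= ge_max lerDl ler01
    ?andbT /=; have := le1 i; rewrite ler_norml => /andP[? ?]; lra.
case=> x [xu xv]; apply/forallP => i.
move: (xu i) (xv i); rewrite !mxE !in_itv /= => /andP[? ?] /andP[? ?].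
by rewrite ler_norml; apply/andP; split; lra.
Qed.

Lemma cubicity_le (R : realType) (T : finType) (G : sgraph T) k :
  cube_representable R G k -> (cubicity R G <= k)%N.
Proof.
move=> repr; rewrite /cubicity; case: ex_minnP => j _; apply.
exact/asboolP.
Qed.

(* By averaging, some [w] covers at least a fraction [1 / M] of the [x] that are
   still uncovered. *)
Lemma greedy_cover (W X : finType) (sep : W -> X -> bool) (M : nat)
    (A : {set X}) :
  (0 < M)%N -> (0 < #|W|)%N ->
  (forall x, x \in A -> (#|W| <= M * #|[set w | sep w x]|)%N) ->
  forall K, exists t : K.-tuple W,
    (#|[set x in A | ~~ has (sep^~ x) t]| * M ^ K <= #|A| * M.-1 ^ K)%N.
Proof.
move=> M0 W0 sepA; elim=> [|K [t IH]].
  exists [tuple]; rewrite !expn0 !muln1; apply/subset_leq_card/fintype.subsetP => x.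
  by rewrite inE => /andP[].
pose B := [set x in A | ~~ has (sep^~ x) t]%SET.
have [w Bw] : exists w, (#|B| <= M * #|[set x in B | sep w x]%SET|)%N.
  apply/existsP; apply: contraT; rewrite negb_exists => /forallP noW.
  have : (\sum_(w : W) M * #|[set x in B | sep w x]%SET| < \sum_(w : W) #|B|)%N.
    have /card_gt0P[w0 _] := W0.
    rewrite (bigD1 w0) // [ltnRHS](bigD1 w0) //= -addSn leq_add //.
      by rewrite ltnNge noW.
    by apply: leq_sum => w _; rewrite ltnW // ltnNge noW.
  rewrite ltnNge -big_distrr /= => /negP; case.
  rewrite [leqLHS]sum_nat_const mulnC.
  have -> : (\sum_(w : W) #|[set x in B | sep w x]%SET| =
     \sum_(x in B) #|[set w | sep w x]%SET|)%N.
    under eq_bigr do rewrite -sum1_card.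
    under [RHS]eq_bigr do rewrite -sum1_card.
    rewrite (exchange_big_dep (mem B)) /=; last by move=> w x _; rewrite inE => /andP[].
    apply: eq_bigr => x xB; apply: eq_bigl => w.
    by rewrite [in LHS]inE [in RHS]inE xB.
  rewrite big_distrr /= -sum_nat_const; apply: leq_sum => x.
  by rewrite inE => /andP[/sepA].
exists [tuple of w :: t].
have -> : [set x in A | ~~ has (sep^~ x) [tuple of w :: t]]%SET =
    B :\: [set x in B | sep w x]%SET.
  apply/setP => x; rewrite !inE /= negb_or.
  by case: (x \in A) (sep w x) (has _ _) => [] [] [].
rewrite cardsD (_ : B :&: _ = [set x in B | sep w x]%SET); last first.
  by apply/setP => x; rewrite !inE; case: (x \in A) (has _ _) => [] [].
set b := #|B| in IH Bw *; set c := #|_| in Bw *.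
rewrite !expnS.
have : ((b - c) * M <= b * M.-1)%N by case: M M0 Bw {sepA IH} => // M _ /=; nia.
move=> h; rewrite mulnA (leq_trans (leq_mul h (leqnn _))) //.
by rewrite mulnAC [leqRHS]mulnCA mulnC leq_mul2l IH orbT.
Qed.

(** The vertices of colour [ord0] in a uniform colouring form a random set of density [1 / (D + 1)].
    It contains [v] and misses [B] with probability [(1 / (D + 1)) (1 - 1 / (D + 1))^#|B|], and the
    second factor is at least 1/2. *)
Lemma card_isolating_ffun (T : finType) (D : nat) (v : T) (B : {set T}) :
  v \notin B -> (#|B|.*2 <= D.+1)%N ->
  (#|{ffun T -> 'I_D.+1}| <= D.+1.*2 *
    #|[set c : {ffun T -> 'I_D.+1} |
        (c v == ord0) && [forall w in B, c w != ord0]]|)%N.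
Proof.
move=> vB BD.
pose F (w : T) : pred 'I_D.+1 :=
  if w == v then pred1 ord0 else if w \in B then predC1 ord0 else predT.
have -> : [set c : {ffun T -> 'I_D.+1} |
        (c v == ord0) && [forall w in B, c w != ord0]]%SET = [set c in family F]%SET.
  apply/setP => c; rewrite !inE; apply/andP/familyP.
    move=> [cv /forall_inP cB] w; rewrite /F; case: eqP => [->//|_].
    by case: ifP => // /cB.
  move=> cF; split; first by have := cF v; rewrite /F eqxx.
  apply/forall_inP => w wB; have := cF w; rewrite /F wB.
  by case: eqP vB => // <-; rewrite wB.
rewrite cardsE card_family card_ffun card_ord foldrE big_map big_enum /=.
rewrite (bigD1 v) //= {1}/F eqxx card1 mul1n.
have -> : (\prod_(i | i != v) #|F i| =
   D ^ #|B| * D.+1 ^ (#|T|.-1 - #|B|))%N.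
  rewrite (bigID (mem B)) /=; congr (_ * _)%N.
    rewrite -prod_nat_const (eq_bigl (mem B)) => [|i]; last first.
      by apply: andb_idl => iB; apply: contraNneq vB => <-.
    apply: eq_bigr => i; rewrite inE => iB; rewrite /F iB.
    case: eqP vB => [<-|_ _]; first by rewrite iB.
    by rewrite cardC1 card_ord.
  under eq_bigr => i /andP[/negbTE iv /negbTE iB] do rewrite /F iv iB card_ord.
  rewrite prod_nat_const; congr (_ ^ _)%N.
  have -> : #|[pred i | i != v & i \notin B]| = #|~: (v |: B)|.
    by apply: eq_card => i; rewrite !inE negb_or.
  have := cardsC (v |: B); rewrite cardsU1 vB /= => <-; lia.
have BT : (#|B| < #|T|)%N.
  have := subset_leq_card (finset.subsetT (v |: B)); rewrite cardsU1 vB cardsT /=; lia.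
(* Bernoulli's inequality [(1 - 1 / (D + 1))^b >= 1 - b / (D + 1)], cleared of denominators. *)
have bern b : (b <= D.+1)%N -> (D.+1 ^ b * (D.+1 - b) <= D ^ b * D.+1)%N.
  elim: b => [|b IHb] bD; first by rewrite subn0.
  rewrite !expnS; have := IHb (ltnW bD); nia.
have half : (D.+1 ^ #|B| <= 2 * D ^ #|B|)%N.
  have := bern #|B|; move: (D.+1 ^ _)%N (D ^ _)%N => x y; nia.
have [a ->] : exists a, #|T| = (a + #|B|.+1)%N.
  by exists (#|T| - #|B|.+1)%N; rewrite subnK.
rewrite (_ : (a + #|B|.+1).-1 - #|B| = a)%N; last by lia.
rewrite [leqRHS](_ : _ = D.+1 ^ a * (D.+1 * (2 * D ^ #|B|)))%N; last first.
  by rewrite -mul2n; ring.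
by rewrite expnD expnS !leq_mul.
Qed.

(** * Vertex orders with few earlier neighbours, and the coordinates they give *)

Definition back (T : finType) (G : sgraph T) (pi : T -> nat) (u : T) : {set T} :=
  [set w | adj G w u & (pi w < pi u)%N]%SET.

(** By induction on the vertex set: a vertex of low degree receives the last rank, which leaves the
    earlier neighbours of all others unchanged. *)
Lemma degenerate_order (T : finType) (G : sgraph T) (k : nat) :
  (forall H : {set T}, H != finset.set0 ->
     exists2 v, v \in H & (#|[set w in H | adj G w v]| <= k)%N) ->
  exists pi : T -> nat, [/\ injective pi, forall u, (pi u < #|T|)%N &
    forall u, (#|back G pi u| <= k)%N].
Proof.
move=> low.
suff main (H : {set T}) : exists pi : T -> nat,
  [/\ {in H &, injective pi}, {in H, forall u, (pi u < #|H|)%N} &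
      {in H, forall u, (#|[set w in H | adj G w u & (pi w < pi u)%N]%SET| <= k)%N}].
  have [pi [pi_inj pi_lt piB]] := main [set: T]%SET.
  exists pi; split=> [u v|u|u]; first by apply: pi_inj; rewrite inE.
    by rewrite -cardsT pi_lt ?inE.
  rewrite (_ : back _ _ _ =
    [set w in [set: T] | adj G w u & (pi w < pi u)%N]%SET) ?piB ?inE //.
  by apply/setP => w; rewrite !inE.
have [n] := ubnP #|H|; elim: n H => // n IHn H Hn.
have [->|/low[v vH vk]] := eqVneq H finset.set0.
  by exists (fun=> 0%N); split=> [u|u|u]; rewrite inE.
have cH := cardsD1 v H; rewrite vH add1n in cH.
have [|pi [pi_inj pi_lt piB]] := IHn (H :\ v); first by rewrite -ltnS -cH.
pose pi' u := if u == v then #|H :\ v| else pi u.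
have pi'_lt u : u \in H -> u != v -> (pi' u < #|H :\ v|)%N.
  by move=> uH uv; rewrite /pi' (negbTE uv) pi_lt // !inE uv.
have pi'v : pi' v = #|H :\ v| by rewrite /pi' eqxx.
exists pi'; split=> [u w uH wH|u uH|u uH].
- have [->|uv] := eqVneq u v; have [->|wv] := eqVneq w v => //.
  + by move=> e; have := pi'_lt w wH wv; rewrite -e pi'v ltnn.
  + by move=> e; have := pi'_lt u uH uv; rewrite e pi'v ltnn.
  by rewrite /pi' (negbTE uv) (negbTE wv); apply: pi_inj; rewrite !inE ?uv ?wv.
- rewrite cH ltnS; have [->|uv] := eqVneq u v; first by rewrite pi'v.
  by rewrite ltnW ?pi'_lt.
- have [->|uv] := eqVneq u v.
    apply: leq_trans vk; apply/subset_leq_card/fintype.subsetP => w.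
    by rewrite !inE => /and3P[-> ->].
  have uHv : u \in H :\ v by rewrite !inE uv.
  apply: leq_trans (piB u uHv).
  apply/subset_leq_card/fintype.subsetP => w; rewrite !inE => /and3P[wH wu].
  have [->|wv] := eqVneq w v.
    by rewrite pi'v ltnNge ltnW // pi'_lt.
  by rewrite wH wu /pi' (negbTE uv) (negbTE wv).
Qed.

(* The value is [n] when [u] has no neighbour in [S]. *)
Definition first_nbr (T : finType) (G : sgraph T) (pi : T -> nat) (n : nat)
    (S : {set T}) (u : T) : nat :=
  find (fun j => [exists w in S, adj G w u && (pi w == j)]) (iota 0 n).

(* Scaled by [1 / n], so that adjacent vertices are at distance at most [n],
   this is one coordinate of the cube representation. *)
Definition spread (T : finType) (G : sgraph T) (pi : T -> nat) (n : nat)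
    (S : {set T}) (u : T) : nat :=
  if u \in S then pi u else (n + first_nbr G pi n S u)%N.

Lemma first_nbr_le (T : finType) (G : sgraph T) (pi : T -> nat) (n : nat)
    (S : {set T}) u :
  (first_nbr G pi n S u <= n)%N.
Proof. by rewrite -[leqRHS](size_iota 0) find_size. Qed.

Lemma first_nbr_adj (T : finType) (G : sgraph T) (pi : T -> nat) (n : nat)
    (S : {set T}) u w :
  (forall u, (pi u < n)%N) ->
  w \in S -> adj G w u -> (first_nbr G pi n S u <= pi w)%N.
Proof.
move=> pi_lt wS wu; rewrite leqNgt; apply/negP => /(before_find 0%N) /=.
rewrite nth_iota // => /negbT/exists_inP; apply.
by exists w => //; rewrite wu eqxx.
Qed.

(** Members of [S] have values below [n], the others values in [[n, 2n]]. Adjacency matters only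
    when [u] lies outside [S] and [v] inside: then [v] is a candidate for the first neighbour of
    [u]. *)
Lemma spread_adj (T : finType) (G : sgraph T) (pi : T -> nat) (n : nat)
    (S : {set T}) u v :
  (forall u, (pi u < n)%N) ->
  adj G u v -> (spread G pi n S u <= spread G pi n S v + n)%N.
Proof.
move=> pi_lt uv; rewrite /spread; case: ifP => uS; case: ifP => vS.
- by rewrite (leq_trans (ltnW (pi_lt u))) ?leq_addl.
- by rewrite (leq_trans (ltnW (pi_lt u))) ?leq_addl.
- by rewrite addnC leq_add2r first_nbr_adj // adjC.
- by rewrite leq_add ?leq_addr ?first_nbr_le.
Qed.

(** No neighbour of [u] in [S] precedes [u], so the first one has rank at least [pi u > pi v]; if
    there is none, the default [n] also exceeds [pi v]. *)
Lemma spread_sep (T : finType) (G : sgraph T) (pi : T -> nat) (n : nat)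
    (S : {set T}) u v :
  (forall u, (pi u < n)%N) ->
  v \in S -> u \notin S -> (pi v < pi u)%N ->
  {in back G pi u, forall w, w \notin S} ->
  (spread G pi n S v + n < spread G pi n S u)%N.
Proof.
move=> pi_lt vS uS vu backS; rewrite /spread vS (negbTE uS) addnC ltn_add2l.
have [fn|nf] := leqP n (first_nbr G pi n S u); first exact: leq_trans fn.
rewrite (leq_trans vu) // leqNgt; apply/negP => fu.
have : has (fun j => [exists w in S, adj G w u && (pi w == j)]) (iota 0 n).
  by rewrite has_find size_iota.
move/(nth_find 0%N) => /=; rewrite -/(first_nbr G pi n S u) nth_iota // add0n.
move=> /= /exists_inP[w wS /andP[wu /eqP pw]].
by have := backS w; rewrite inE wu pw fu wS => /(_ isT).
Qed.

(** Fewer than [#|T|^2 (1 - 1 / (8q))^K < 1] non-adjacent pairs remain unseparated after [K]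
    greedily chosen colourings, hence none; each colouring gives one coordinate. *)
Lemma cubicity_degenerate (R : realType) (T : finType) (G : sgraph T)
    (pi : T -> nat) (q K : nat) :
  injective pi -> (forall u, (pi u < #|T|)%N) ->
  (0 < q)%N -> (forall u, (#|back G pi u| < q.*2)%N) ->
  (#|T| ^ 2 * (8 * q).-1 ^ K < (8 * q) ^ K)%N ->
  (cubicity R G <= K)%N.
Proof.
move=> pi_inj pi_lt q0 backq covK.
(* The set to avoid consists of a vertex and its fewer than [2q] earlier neighbours, so it has at
   most [2q] elements, half the number [4q] of colours. *)
pose D := (4 * q).-1; have DE : D.+1 = (4 * q)%N by rewrite /D; lia.
pose W : finType := {ffun T -> 'I_D.+1}.
pose A := [set x : T * T | (pi x.1 < pi x.2)%N && ~~ adj G x.1 x.2].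
pose sep (c : W) (x : T * T) :=
  (c x.1 == ord0) && [forall w in x.2 |: back G pi x.2, c w != ord0].
have sepA x : x \in A -> (#|W| <= 8 * q * #|[set c | sep c x]|)%N.
  rewrite inE => /andP[x12 nx].
  have -> : (8 * q = D.+1.*2)%N by lia.
  apply: card_isolating_ffun.
    rewrite !inE negb_or (negbTE nx) andbT.
    by apply: contraTneq x12 => ->; rewrite ltnn.
  rewrite cardsU1 DE; have := backq x.2; case: (_ \notin _); lia.
have W0 : (0 < #|W|)%N by rewrite card_ffun card_ord expn_gt0.
have q80 : (0 < 8 * q)%N by lia.
have [t tA] := greedy_cover q80 W0 sepA K.
have {tA} covered x : x \in A -> exists i : 'I_K, sep (tnth t i) x.
  move=> xA; have /hasP[c /tnthP[i ->] ?] : has (sep^~ x) t; last by exists i.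
  apply: contraTT covK => nx; rewrite -leqNgt.
  apply: leq_trans (leq_trans tA _); last first.
    by rewrite leq_mul2r -mulnn -card_prod max_card orbT.
  rewrite leq_pmull // card_gt0; apply/set0Pn; exists x.
  by rewrite inE xA.
have [T0|T0] := posnP #|T|.
  apply: cubicity_le; apply: (@cube_representable_dist _ _ _ _ (fun _ _ => 0)).
  by move=> u; have := fintype0 u T0.
pose S (i : 'I_K) := [set w | tnth t i w == ord0].
pose g i u := spread G pi #|T| (S i) u.
apply: cubicity_le.
apply: (@cube_representable_dist _ _ _ _ (fun i u => (g i u)%:R / #|T|%:R)).
move=> u v uv; have Tp : 0 < #|T|%:R :> R by rewrite ltr0n.
have distE i : (`|(g i u)%:R / #|T|%:R - (g i v)%:R / #|T|%:R| <= 1 :> R) =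
    (g i u <= g i v + #|T|)%N && (g i v <= g i u + #|T|)%N.
  rewrite -mulrBl normrM [`|_^-1|]gtr0_norm ?invr_gt0 // ler_pdivrMr // mul1r.
  rewrite ler_distl -!natrD -(ler_nat R) -[X in _ = _ && X](ler_nat R) !natrD.
  by rewrite andbC lerBlDr.
under eq_forallb do rewrite distE.
apply/idP/forallP => [Guv i|close].
  by rewrite !spread_adj // adjC.
apply/negPn/negP => nuv.
wlog vu : u v uv close nuv {distE} / (pi v < pi u)%N.
  move=> th; case: (ltngtP (pi v) (pi u)) => [|vu|/pi_inj e]; first exact: th.
    apply: (th v u); rewrite 1?eq_sym // 1?adjC // => i.
    by rewrite andbC.
  by rewrite e eqxx in uv.
have [|i /andP[/= civ /forall_inP ciu]] := covered (v, u); first by rewrite inE vu adjC.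
have /andP[+ _] := close i; apply/negP; rewrite -ltnNge.
apply: spread_sep => //; rewrite ?inE //.
- by apply: ciu; rewrite !inE eqxx.
- by move=> w wb; rewrite inE; apply: ciu; rewrite inE wb orbT.
Qed.

(** * Estimates for binomial coefficients *)

(** This is ['C(n, k) <= n^k / k!] combined with [k! >= (k / 4)^k]; the latter follows from
    [k^k <= (2k)^_k = 'C(2k, k) k! <= 4^k k!]. *)
Lemma leq_bin_expn n k : ('C(n, k) * k ^ k <= 4 ^ k * n ^ k)%N.
Proof.
have kk : (k ^ k <= 4 ^ k * k`!)%N.
  have h : (k ^ k <= (k + k) ^_ k)%N.
    have : (forall j, j <= k -> k ^ j <= (k + j) ^_ j)%N; last by apply.
    elim=> // j IHj jk; rewrite expnS addnS ffactnS /= leq_mul ?IHj ?(ltnW jk) //.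
    by rewrite ltnW // ltnS leq_addr.
  apply: leq_trans h _; rewrite -bin_ffact leq_mul2r addnn; apply/orP; right.
  rewrite -[4%N]/(2 ^ 2)%N -expnM mul2n.
  move: k.*2 => m; elim: m k => [|m IHm] [|k]; rewrite ?bin0 ?expn_gt0 //.
  by rewrite binS expnS mul2n -addnn leq_add.
have nk : (n ^_ k <= n ^ k)%N.
  elim: k {kk} => // k IHk; by rewrite ffactnSr expnSr leq_mul // leq_subr.
rewrite -(leq_pmul2r (fact_gt0 k)) mulnAC bin_ffact.
by rewrite [leqRHS]mulnAC mulnC leq_mul.
Qed.

(** The quotient of the two binomials is the product of the [(m - i) / (N - i)] for [i < r], each at
    most [m / N]. *)
Lemma leq_bin_sub N m r : (m <= N)%N -> (r <= m)%N ->
  ('C(N - r, m - r) * N ^ r <= 'C(N, m) * m ^ r)%N.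
Proof.
elim: r N m => [|r IHr] N m; first by rewrite !subn0 !expn0.
case: N m => [|N] [|m] // mN rm.
rewrite !subSS !expnS.
have := IHr N m mN rm; have := mul_bin_diag N.+1 m => /=.
move=> bE IH.
(* Since [m <= N], the ratio [m / N] is at most [(m + 1) / (N + 1)], so the induction hypothesis may
   be weakened to the new ratio. *)
have e1 : (m * N.+1 <= m.+1 * N)%N by lia.
have e2 : (m ^ r * N.+1 ^ r <= m.+1 ^ r * N ^ r)%N.
  by rewrite -!expnMn; case: (r) => // r1; rewrite leq_exp2r.
have [N0|N0] := posnP (N ^ r).
  move/eqP: N0; rewrite expn_eq0 => /andP[/eqP N0 r0].
  by move: rm mN r0; rewrite N0; lia.
rewrite -(leq_pmul2r N0).
have -> : ('C(N.+1, m.+1) * (m.+1 * m.+1 ^ r) * N ^ r =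
    (m.+1 * 'C(N.+1, m.+1)) * (m.+1 ^ r * N ^ r))%N by ring.
rewrite -bE.
have -> : ('C(N - r, m - r) * (N.+1 * N.+1 ^ r) * N ^ r =
    N.+1 * N.+1 ^ r * ('C(N - r, m - r) * N ^ r))%N by ring.
apply: (@leq_trans (N.+1 * N.+1 ^ r * ('C(N, m) * m ^ r))%N).
  by rewrite leq_mul2l IH orbT.
by rewrite [leqLHS](_ : _ = (N.+1 * 'C(N, m)) * (m ^ r * N.+1 ^ r))%N
  ?leq_mul2l ?e2 ?orbT //; ring.
Qed.

(** * Counting the graphs that have a dense vertex set *)

Definition pairs (T : finType) (H : {set T}) : {set {set T}} :=
  [set e : {set T} | (e \subset H) & #|e| == 2%N]%SET.

Lemma card_pairs (T : finType) (H : {set T}) : #|pairs H| = 'C(#|H|, 2)%N.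
Proof. exact: cards_draws. Qed.

Lemma edges_pairs (T : finType) (G : sgraph T) : edges G \subset pairs [set: T].
Proof.
apply/fintype.subsetP => e eG; rewrite inE finset.subsetT.
by have /forall_inP/(_ e eG) := edges_card2 G.
Qed.

Lemma card_Gnm n m : #|Gnm n m| = 'C('C(n, 2), m)%N.
Proof.
rewrite -[n in RHS]card_ord -cardsT -card_pairs -cards_draws.
rewrite -(card_imset _ (val_inj : injective (@edges 'I_n))).
apply: eq_card => E; rewrite inE; apply/imsetP/andP.
  by case=> G; rewrite inE => mG ->; split; rewrite // edges_pairs.
case=> /fintype.subsetP EP mE.
have E2 : [forall e in E, #|e| == 2%N].
  by apply/forall_inP => e /EP; rewrite inE => /andP[].
by exists (SGraph E2); rewrite ?inE.
Qed.

(** Deleting [F] from the edge set is injective on these graphs. The boolean factor is needed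
    because truncated subtraction would make the binomial 1 when [m < #|F|]. *)
Lemma card_Gnm_sup n m (F : {set {set 'I_n}}) : F \subset pairs [set: 'I_n] ->
  (#|[set G in Gnm n m | F \subset edges G]| <=
     (#|F| <= m) * 'C('C(n, 2) - #|F|, m - #|F|))%N.
Proof.
move=> FP; have [Fm|mF] := leqP #|F| m; last first.
  rewrite mul0n leqn0 cards_eq0; apply/eqP/setP => G; rewrite !inE.
  apply/negP => /andP[/eqP mG /subset_leq_card]; lia.
rewrite mul1n -[in 'C(n, 2)](card_ord n) -cardsT -card_pairs.
have -> : (#|pairs [set: 'I_n]| - #|F| = #|pairs [set: 'I_n] :\: F|)%N.
  by rewrite cardsD (finset.setIidPr FP).
rewrite -cards_draws.
pose f (G : sgraph 'I_n) := edges G :\: F.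
rewrite -(@card_in_imset _ _ f); last first.
  move=> G G'; rewrite !inE /f => /andP[_ FG] /andP[_ FG'] e.
  apply: val_inj; rewrite /= -(setID (edges G) F) -(setID (edges G') F) e.
  by rewrite (finset.setIidPr FG) (finset.setIidPr FG').
apply/subset_leq_card/fintype.subsetP => E /imsetP[G].
rewrite !inE => /andP[/eqP mG FG] ->.
by rewrite finset.setSD ?edges_pairs //= cardsD mG (finset.setIidPr FG).
Qed.

(** Double counting: if all degrees inside [H] were at least [2q], their sum would be at least
    [2q #|H|], while each edge is counted at most twice. *)
Lemma sparse_low_degree (T : finType) (G : sgraph T) (H : {set T}) (q : nat) :
  (#|edges G :&: pairs H| < #|H| * q)%N ->
  exists2 v, v \in H & (#|[set w in H | adj G w v]| < q.*2)%N.
Proof.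
move=> sparse; apply/exists_inP; apply: contraTT sparse => /exists_inPn high.
rewrite -leqNgt -(leq_pmul2l (isT : (0 < 2)%N)) mulnCA mul2n.
set E := edges G :&: pairs H.
have degE v : v \in H ->
    (#|[set w in H | adj G w v]%SET| <= #|[set e in E | v \in e]%SET|)%N.
  move=> vH; rewrite -(@card_in_imset _ _ (fun w => [set w; v]%SET)); last first.
    move=> w w'; rewrite !inE => /andP[_ wv] /andP[_ wv'] /setP/(_ w).
    rewrite !inE eqxx /= => /esym /orP[/eqP//|/eqP e].
    have /forall_inP/(_ _ wv) := edges_card2 G.
    by rewrite e finset.setUid cards1.
  apply/subset_leq_card/fintype.subsetP => e /imsetP[w].
  rewrite inE => /andP[wH wv] ->.
  have /forall_inP/(_ _ wv) wv2 := edges_card2 G.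
  rewrite !inE eqxx orbT wv2 andbT -[_ \in edges G]/(adj G w v) wv /= andbT.
  by apply/fintype.subsetP => x; rewrite !inE => /orP[] /eqP ->.
rewrite -sum_nat_const.
apply: (@leq_trans (\sum_(v in H) #|[set e in E | v \in e]%SET|)).
  by apply: leq_sum => v vH; rewrite (leq_trans _ (degE v vH)) // leqNgt high.
under eq_bigr do rewrite -sum1_card.
rewrite (exchange_big_dep (mem E)) /=; last by move=> v e _; rewrite inE => /andP[].
rewrite mulnC -sum_nat_const; apply: leq_sum => e eE.
rewrite sum1_card; have : #|e| == 2%N by move: eE; rewrite !inE => /and3P[].
move/eqP <-; apply/subset_leq_card/fintype.subsetP => v.
by rewrite unfold_in /= => /andP[_]; rewrite inE => /andP[].
Qed.

Definition has_dense_subset (T : finType) (q : nat) (G : sgraph T) : bool :=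
  [exists H : {set T}, (H != finset.set0) && (#|H| * q <= #|edges G :&: pairs H|)%N].

Lemma leq_card_bigcup (I T : finType) (P : pred I) (F : I -> {set T}) :
  (#|\bigcup_(i | P i) F i|%SET <= \sum_(i | P i) #|F i|)%N.
Proof.
elim/big_rec2: _ => [|i k A _ Ak]; first by rewrite cards0.
by rewrite (leq_trans (leq_card_setU _ _).1) // leq_add2l.
Qed.

(** Union bound over [H] and over the sets [F] of exactly [#|H| q] pairs inside [H]. The bound for
    [H] depends only on [s = #|H|], so the sets are grouped by size. *)
Lemma card_dense_subset n m q :
  (#|[set G in Gnm n m | has_dense_subset q G]| <=
   \sum_(1 <= s < n.+1) 'C(n, s) * ('C('C(s, 2), s * q) *
      ((s * q <= m) * 'C('C(n, 2) - s * q, m - s * q))))%N.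
Proof.
pose D (H : {set 'I_n}) :=
  [set F : {set {set 'I_n}} | F \subset pairs H & #|F| == (#|H| * q)%N]%SET.
pose B H := \bigcup_(F in D H) [set G in Gnm n m | F \subset edges G]%SET.
pose f s := ('C('C(s, 2), s * q) *
      ((s * q <= m) * 'C('C(n, 2) - s * q, m - s * q)))%N.
apply: (@leq_trans #|\bigcup_(H : {set 'I_n} | H != finset.set0) B H|%SET).
  apply/subset_leq_card/fintype.subsetP => G; rewrite inE => /andP[Gm].
  move=> /existsP[H /andP[H0 dense]]; apply/bigcupP; exists H => //.
  have : (0 < #|[set F : {set {set 'I_n}} |
      F \subset edges G :&: pairs H & #|F| == (#|H| * q)%N]%SET|)%N.
    by rewrite cards_draws bin_gt0.
  move=> /card_gt0P[F]; rewrite !inE finset.subsetI => /andP[/andP[FG FH] cF].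
  by apply/bigcupP; exists F; rewrite !inE ?FH // FG andbT; rewrite inE in Gm.
apply: leq_trans (leq_card_bigcup _ _) _.
apply: (@leq_trans (\sum_(H : {set 'I_n} | H != finset.set0) f #|H|)).
  apply: leq_sum => H _; apply: leq_trans (leq_card_bigcup _ _) _.
  rewrite /f -card_pairs -cards_draws -sum_nat_const; apply: leq_sum => F.
  rewrite inE => /andP[FH /eqP <-]; apply: card_Gnm_sup.
  apply: fintype.subset_trans FH _; apply/fintype.subsetP => e.
  by rewrite !inE finset.subsetT => /andP[].
have cH (H : {set 'I_n}) : (#|H| < n.+1)%N.
  by rewrite ltnS -[leqRHS](card_ord n) max_card.
rewrite (big_nat_widenl 1 0) // big_mkord.
rewrite (partition_big (fun H : {set 'I_n} => inord #|H| : 'I_n.+1)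
  (fun s : 'I_n.+1 => true && (0 < s)%N)) /=; last first.
  by move=> H; rewrite inordK // -card_gt0.
apply: leq_sum => s s0.
rewrite (eq_bigr (fun=> f s)) => [|H /andP[_ /eqP <-]]; last by rewrite inordK.
rewrite sum_nat_const leq_mul2r; apply/orP; right.
rewrite -[n in 'C(n, _)]card_ord -card_draws; apply/subset_leq_card/fintype.subsetP => H.
by rewrite !inE => /andP[_ /eqP <-]; rewrite inordK.
Qed.

(** * Summing the union bound *)

Lemma sum_geometric_le (a : nat -> nat) (Z n : nat) :
  (forall s, 0 < s <= n -> 2 ^ s * a s <= Z)%N ->
  (\sum_(1 <= s < n.+1) a s <= Z)%N.
Proof.
(* The induction needs the sharper bound [(1 - 2^-n) Z], here multiplied by [2^n]. *)
move=> aZ; suff : (2 ^ n * (\sum_(1 <= s < n.+1) a s) + Z <= 2 ^ n * Z)%N.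
  have : (0 < 2 ^ n)%N by rewrite expn_gt0.
  move: (2 ^ n)%N (\sum_(_ <= _ < _) _)%N => x y; nia.
elim: n aZ => [|n IHn] aZ; first by rewrite big_geq // muln0 mul1n.
have {}IHn : (2 ^ n * (\sum_(1 <= s < n.+1) a s) + Z <= 2 ^ n * Z)%N.
  by apply: IHn => s /andP[s0 sn]; apply: aZ; rewrite s0 ltnW.
have := aZ n.+1 (leqnn _); rewrite big_nat_recr //= !expnS.
by move: IHn; move: (\sum_(_ <= _ < _) _)%N (2 ^ n)%N => x y; nia.
Qed.

Lemma leq_expn2 m n e : (m <= n)%N -> (m ^ e <= n ^ e)%N.
Proof. by case: e => // e mn; rewrite leq_exp2r. Qed.

(* With [r = s q], [N = 'C(n, 2)] and [M = 'C(s, 2)], the three binomials are at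
   most [(4n/s)^s], [(4M/r)^r] and [(m/N)^r 'C(N, m)], and [4Mm/(rN) <= s/(2n)]. *)
Lemma dense_term_le n m q s :
  (0 < s <= n)%N -> (m <= 'C(n, 2))%N -> (8 * m < q * n)%N -> (4 <= q)%N ->
  (2 ^ s * (n * ('C(n, s) * ('C('C(s, 2), s * q) *
      ((s * q <= m) * 'C('C(n, 2) - s * q, m - s * q))))) <= 'C('C(n, 2), m))%N.
Proof.
move=> /andP[s0 sn] mN mq q4.
have [rm|_] := leqP (s * q) m; last by rewrite mul0n !muln0.
rewrite mul1n; set r := (s * q)%N in rm *; set N := 'C(n, 2) in mN *.
set M := 'C(s, 2); set Z := 'C(N, m).
set T := ('C(n, s) * _)%N.
have r0 : (0 < r)%N by rewrite muln_gt0 s0; lia.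
have N0 : (0 < N)%N by lia.
have n0 : (0 < n)%N by lia.
have h1 : (T * s ^ s * (r * N) ^ r <= (4 * n) ^ s * (4 * M * m) ^ r * Z)%N.
  have a1 := leq_bin_expn n s; have a2 := leq_bin_expn M r.
  have a3 := leq_bin_sub mN rm.
  have := leq_mul (leq_mul a1 a2) a3; rewrite !expnMn /T -/Z.
  by congr (_ <= _)%N; ring.
have h2 : (4 * M * m * (2 * n) <= s * (r * N))%N.
  have M2 : (2 * M = s * s.-1)%N by rewrite -mul_bin_diag bin1.
  have N2 : (2 * N = n * n.-1)%N by rewrite -mul_bin_diag bin1.
  (* From [8m < qn] and [n (s - 1) <= s (n - 1)], which holds as [s <= n]. *)
  have : (8 * m * s.-1 <= s * q * n.-1)%N.
    apply: (@leq_trans (q * n * s.-1)%N); first by rewrite leq_mul2r ltnW ?orbT.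
    rewrite -mulnA [leqRHS]mulnAC mulnC leq_mul2r; apply/orP; right.
    by move: s0 sn n0; case: (s) (n) => [|s'] // [|n'] //= _ ? _; nia.
  move/(leq_mul (leqnn (s * n)%N)) => h.
  rewrite -(leq_pmul2l (isT : (0 < 2)%N)).
  rewrite [leqLHS](_ : _ = (8 * (2 * M) * m * n))%N; last by ring.
  rewrite [leqRHS](_ : _ = (s * r * (2 * N)))%N; last by ring.
  rewrite M2 N2 /r; move: h; congr (_ <= _)%N; ring.
have {h1 h2} h3 : (T * s ^ s * (2 * n) ^ r <= (4 * n) ^ s * s ^ r * Z)%N.
  have rN0 : (0 < (r * N) ^ r)%N by rewrite expn_gt0 muln_gt0 r0 N0.
  rewrite -(leq_pmul2r rN0).
  have h4 : ((4 * M * m) ^ r * (2 * n) ^ r <= s ^ r * (r * N) ^ r)%N.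
    by rewrite -!expnMn leq_exp2r.
  apply: leq_trans (_ : (4 * n) ^ s * Z * ((4 * M * m) ^ r * (2 * n) ^ r) <= _)%N.
    rewrite [leqLHS](_ : _ = (T * s ^ s * (r * N) ^ r) * (2 * n) ^ r)%N; last by ring.
    rewrite [leqRHS](_ : _ = ((4 * n) ^ s * (4 * M * m) ^ r * Z) * (2 * n) ^ r)%N;
      last by ring.
    by rewrite leq_mul.
  rewrite [leqRHS](_ : _ = (4 * n) ^ s * Z * (s ^ r * (r * N) ^ r))%N; last by ring.
  by rewrite leq_mul.
(* As [s / (2n) <= 1] and [r >= 4s], the exponent [r] may be lowered to [4s]; one power [s^s] then
   cancels. *)
have {h3} h5 : (T * (2 * n) ^ (4 * s) <= (4 * n) ^ s * s ^ (3 * s) * Z)%N.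
  have [p rE] : exists p, r = (4 * s + p)%N.
    by exists (r - 4 * s)%N; rewrite subnKC // /r mulnC leq_mul.
  have np : (0 < (2 * n) ^ p * s ^ s)%N by rewrite muln_gt0 !expn_gt0 muln_gt0 n0 s0.
  rewrite -(leq_pmul2r np).
  rewrite [leqLHS](_ : _ = T * s ^ s * (2 * n) ^ r)%N; last by rewrite rE expnD; ring.
  apply: leq_trans h3 _.
  rewrite [leqRHS](_ : _ = (4 * n) ^ s * s ^ (4 * s) * Z * (2 * n) ^ p)%N; last first.
    by rewrite (_ : 4 * s = 3 * s + s)%N ?expnD; [ring | lia].
  rewrite rE expnD.
  rewrite [leqLHS](_ : _ = (4 * n) ^ s * s ^ (4 * s) * Z * s ^ p)%N; last by ring.
  rewrite leq_mul // leq_expn2; lia.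
have h6 : (4 ^ s * T * n ^ (3 * s) <= s ^ (3 * s) * Z)%N.
  have np : (0 < (4 * n) ^ s)%N by rewrite expn_gt0 muln_gt0 n0.
  rewrite -(leq_pmul2r np).
  rewrite [leqRHS](_ : _ = (4 * n) ^ s * s ^ (3 * s) * Z)%N; last by ring.
  apply: leq_trans h5.
  rewrite !expnMn (_ : 2 ^ (4 * s) = 4 ^ s * 4 ^ s)%N; last by rewrite -expnMn expnM.
  rewrite (_ : 4 * s = 3 * s + s)%N; last by lia.
  by rewrite expnD eq_leq //; ring.
(* [(s / n)^(3s) <= s / n] supplies the factor [1 / n] of the failure probability. *)
have h7 : (4 ^ s * (n * T) <= s * Z)%N.
  have np : (0 < n ^ (3 * s).-1)%N by rewrite expn_gt0 n0.
  rewrite -(leq_pmul2r np).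
  apply: leq_trans (_ : s ^ (3 * s) * Z <= _)%N.
    apply: leq_trans h6; rewrite -[in leqRHS](@prednK (3 * s)) ?muln_gt0 //.
    by rewrite expnS eq_leq //; ring.
  rewrite -[in leqLHS](@prednK (3 * s)) ?muln_gt0 // expnS -!mulnA leq_mul //.
  rewrite mulnC leq_mul //.
  by rewrite leq_expn2.
(* Of [4^s = 2^s 2^s], one factor absorbs [s] and the other is the weight of the geometric sum. *)
have sp : (0 < 2 ^ s)%N by rewrite expn_gt0.
rewrite -(leq_pmul2l sp) mulnA -expnMn; apply: leq_trans h7 _.
by rewrite leq_mul // ltnW // ltn_expl.
Qed.

(** * From sparsity to cubicity, and the probability bound *)

(** Take [K] to be the first integer above [16 q ln n]: then [(1 - 1 / (8q))^K <= exp(- K / (8q)) <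
    n^-2]. The summand 1 pays for the rounding. *)
Lemma cubicity_no_dense_subset (R : realType) (T : finType) (G : sgraph T) (q : nat) :
  (0 < q)%N -> ~~ has_dense_subset q G -> (1 < #|T|)%N ->
  (cubicity R G)%:R <= 16 * q%:R * ln (#|T|%:R : R) + 1.
Proof.
move=> q0 sparse n1; set n := #|T| in n1 *.
have [pi [pi_inj pi_lt backq]] : exists pi : T -> nat,
    [/\ injective pi, forall u, (pi u < #|T|)%N &
        forall u, (#|back G pi u| <= q.*2.-1)%N].
  apply: degenerate_order => H H0.
  have [|v vH vq] := @sparse_low_degree T G H q; last first.
    by exists v; rewrite // -ltnS prednK // double_gt0.
  rewrite ltnNge; apply: contra sparse => dense.
  by apply/existsP; exists H; rewrite H0.
set x := 16 * q%:R * ln n%:R.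
have n0 : 0 < n%:R :> R by rewrite ltr0n ltnW.
have x0 : 0 <= x by rewrite !mulr_ge0 ?ln_ge0 ?ler1n ?(ltnW n1).
apply: (@le_trans _ _ (Num.trunc x).+1%:R); last first.
  by rewrite -natr1 lerD2r truncn_le.
rewrite ler_nat; apply: (cubicity_degenerate _ pi_inj pi_lt q0).
  by move=> u; have := backq u; lia.
have q8 : 0 < (8 * q)%:R :> R by rewrite ltr0n muln_gt0.
rewrite -(ltr_nat R) natrM !natrX.
set K := (Num.trunc x).+1; rewrite -/n.
have step : (8 * q).-1%:R <= (8 * q)%:R * expR (- (8 * q)%:R^-1) :> R.
  rewrite -ler_pdivrMl //; apply: le_trans (expR_ge1Dx _).
  by rewrite -subn1 natrB ?muln_gt0 // mulrBr mulVf ?gt_eqF // mulr1.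
have expK : #|T|%:R ^+ 2 < expR (8 * q)%:R^-1 ^+ K :> R.
  rewrite -[_%:R](@lnK R) ?posrE // -!expRM_natl ltr_expR ltr_pdivlMr //.
  apply: le_lt_trans (truncnS_gt x); rewrite /x natrM; lra.
apply: le_lt_trans
  (_ : _ <= #|T|%:R ^+ 2 * ((8 * q)%:R ^+ K *
    expR (- (8 * q)%:R^-1) ^+ K)) _.
  by rewrite -exprMn ler_pM2l ?exprn_gt0 // lerXn2r // nnegrE ?mulr_ge0 ?expR_ge0.
rewrite expRN exprVn mulrA ltr_pdivrMr ?exprn_gt0 ?expR_gt0 // mulrC.
by rewrite ltr_pM2l ?exprn_gt0.
Qed.

Theorem theorem8 (R : realType) :
  exists C C' : R, [/\ 0 < C, 0 < C' &
    forall n m : nat,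
      (2 <= n)%N ->
      1 <= 2 * m%:R / n%:R :> R ->
      (m <= 'C(n, 2))%N ->
      1 - C' / n%:R <=
        Pr_Gnm R m (fun G : sgraph 'I_n =>
          (cubicity R G)%:R <= C * (2 * m%:R / n%:R) * ln (n%:R : R))].
Proof.
(* With [q <= 5d], the main term [16 q L] is at most [80 d L], and the summand 1 is at most [2 d L]
   because [d >= 1] and [L >= 1 / 2]. *)
exists 82, 1; split; rewrite ?ltr0n // => n m n2 d1 mN.
have n0 : 0 < n%:R :> R by rewrite ltr0n; lia.
set d := 2 * m%:R / n%:R in d1 *.
have nm : (n <= 2 * m)%N.
  by move: d1; rewrite /d ler_pdivlMr // mul1r -natrM ler_nat.
(* The least [q] with [8m < qn]; the assumption [2m >= n] makes it at least 4. *)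
pose q := (8 * m %/ n).+1.
have q4 : (4 <= q)%N by rewrite ltnW // ltnS leq_divRL; lia.
have mq : (8 * m < q * n)%N by rewrite -ltn_divLR //; lia.
have qd : q%:R <= 5 * d :> R.
  have : (8 * m %/ n)%:R <= 4 * d :> R.
    rewrite /d mulrA ler_pdivlMr // mulrA -!natrM ler_nat.
    by rewrite (leq_trans (leq_trunc_div _ _)).
  rewrite /q -natr1; move: d1; lra.
set L := ln (n%:R : R).
(* Here [exp(1/2) <= 2 <= n], since [exp(-1/2) >= 1 - 1/2]. *)
have L12 : 1 / 2 <= L :> R.
  rewrite -ler_expR lnK ?posrE //; apply: (@le_trans _ _ 2); last by rewrite ler_nat.
  have := expR_ge1Dx (- (1 / 2) : R); rewrite expRN.
  have := expR_gt0 (1 / 2 : R); move: (expR _) => e e0 h.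
  have := ler_wpM2r (ltW e0) h; rewrite mulVf ?gt_eqF //; lra.
have Z0 : (0 < #|Gnm n m|)%N by rewrite card_Gnm bin_gt0.
rewrite /Pr_Gnm; set good := (X in #|pred_of_set X|%:R / _).
pose bad := [set G in Gnm n m | has_dense_subset q G].
have nbad : (n * #|bad| <= #|Gnm n m|)%N.
  rewrite card_Gnm.
  apply: leq_trans (leq_mul (leqnn n) (card_dense_subset n m q)) _.
  rewrite big_distrr /=; apply: sum_geometric_le => s sn.
  exact: dense_term_le.
have cover : (#|Gnm n m| <= #|good| + #|bad|)%N.
  apply: leq_trans (leq_card_setU _ _).1.
  apply/subset_leq_card/fintype.subsetP => G GZ; rewrite !inE.
  rewrite inE in GZ; rewrite GZ /=; have [|sparse] := boolP (has_dense_subset q G).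
    by rewrite orbT.
  rewrite orbF; have q0 : (0 < q)%N by [].
  have := @cubicity_no_dense_subset R _ G q q0 sparse.
  rewrite card_ord => /(_ n2) h; apply: le_trans h _; rewrite -/L.
  have : q%:R * L <= 5 * d * L by rewrite ler_wpM2r //; lra.
  have : 1 / 2 <= d * L by nra.
  lra.
have Zp : 0 < #|Gnm n m|%:R :> R by rewrite ltr0n.
rewrite ler_pdivlMr // mulrBl div1r mul1r lerBlDr.
apply: (@le_trans _ _ (#|good| + #|bad|)%N%:R); first by rewrite ler_nat.
by rewrite natrD lerD2l ler_pdivlMl // -natrM; rewrite ler_nat.
Qed.
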